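(* Let $(a_n)_{n\ge 1}$ be any sequence of integers. Then whenever $\mathbb{N}=\{1,2,3,\dots\}$ is finitely coloured, there exist $y\in\mathbb{N}$ and $x_{ni}\in\mathbb{N}$ for all $n\ge 1$ and $1\le i\le n$ such that all of the numbers \[ y,\qquad x_{n1}+x_{n2}+\dots+x_{nn}\ (n\ge 1),\qquad x_{ni}+a_n y\ (n\ge 1,\ 1\le i\le n) \] lie in $\mathbb{N}$ and all have the same colour. (That is, the infinite system of linear expressions consisting of $y$, the sums $x_{n1}+\dots+x_{nn}$, and the expressions $x_{ni}+a_ny$ is image partition regular over $\mathbb{N}$.)
   Context: $\mathbb{N}$ denotes the positive integers. A finite colouring of $\mathbb{N}$ is a map from $\mathbb{N}$ to a finite set; a set of numbers is monochromatic if all its elements receive the same colour. *)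

(* Defs.v *)
From mathcomp Require Import all_boot all_order all_algebra.

Set Implicit Arguments.
Unset Strict Implicit.
Unset Printing Implicit Defensive.

Import GRing.Theory.
Local Open Scope ring_scope.

Definition posnat := {n : nat | (0 < n)%N}.

Definition nat_of_posnat (n : posnat) : nat := val n.
Coercion nat_of_posnat : posnat >-> nat.

(* An expression is evaluated in int, where a coefficient may be negative;
   having a colour includes lying in the domain of the colouring. *)
Definition has_colour (K : finType) (c : posnat -> K) (k : K) (z : int) :=
  exists m : posnat, m%:Z = z /\ c m = k.

(* Main.v *)
Require Import Defs.
From mathcomp Require Import all_boot all_order all_algebra.
From mathcomp Require Import boolp zify ring.

(** Let [A] be the colour class in question, and write [b_i = x_ni + a_n y].
    One needs, for every [n], [b_1, ..., b_n] and [s] in [A] with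
    [b_1 + ... + b_n = s + n a_n y] and [b_i > a_n y].  Call a class large when
    it has positive upper density along the multiples of every integer; the
    union of the other classes misses all of [t, 2t, ..., Mt] for a suitable
    [t], so the multiples of [t] used below have large colours.

    If [A] has positive density, then at most [R] translates of [A] (or of any
    tail of [A]) are pairwise disjoint.  Hence every sum of differences of [A]
    is a sum of at most [2R] of them, and the group [H] of all such sums
    contains [R! Z] and is covered by at most [R] translates [x + (A - A)].
    Some sumset of boundedly many copies of [A] contains a translate of all
    the [-x], so for [n > 2R^2] and [R! | z] the set [(n-1)A - z] meets
    [A - A]; this settles all large [n] as soon as [R! | y].

    For the finitely many remaining [n], density yields [d], a multiple of
    [R! t], such that [A - A] contains any prescribed finite set of multiples
    of [d], for every large class [A] at once.  By pigeonhole two numbers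
    [y = d g^i < u = d g^j] have the same colour, and one takes
    [b_2 = ... = b_n = u] and [b_1 - s = n a_n y - (n-1) u] in [A - A]. *)

Import Order.TTheory GRing.Theory Num.Theory.

Set Implicit Arguments.
Unset Strict Implicit.
Unset Printing Implicit Defensive.

Local Open Scope nat_scope.

(** * Density zero along multiples *)

Definition cnt (A : pred nat) (T : nat) := \sum_(i < T) A i.

Definition null (A : pred nat) :=
  forall e, exists T0, forall T, T0 <= T -> e * cnt A T <= T.

(** Restricting to multiples gives every non-small set arbitrarily large multiples of any positive
    integer, while small sets still form an ideal. *)
Definition small (A : pred nat) :=
  exists2 D, 0 < D & null [pred n | A n && (D %| n)].

Lemma cnt_sub (A B : pred nat) T : subpred A B -> cnt A T <= cnt B T.
Proof.
move=> AB; apply: leq_sum => i _.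
by case Ai: (A i) => //; rewrite AB.
Qed.

Lemma null_sub (A B : pred nat) : subpred A B -> null B -> null A.
Proof.
move=> AB nB e; have [T0 h] := nB e; exists T0 => T /h; apply: leq_trans.
by rewrite leq_mul2l cnt_sub ?orbT.
Qed.

Lemma null_or (A B : pred nat) : null A -> null B -> null [pred n | A n || B n].
Proof.
move=> nA nB e; have [T1 h1] := nA (2 * e); have [T2 h2] := nB (2 * e).
exists (maxn T1 T2) => T; rewrite geq_max => /andP[/h1 {}h1 /h2 {}h2].
have le : cnt [pred n | A n || B n] T <= cnt A T + cnt B T.
  rewrite /cnt -big_split /=; apply: leq_sum => i _.
  by rewrite /=; case: (A i); case: (B i).
have := leq_mul (leqnn e) le; nia.
Qed.

Lemma small_sub (A B : pred nat) : subpred A B -> small B -> small A.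
Proof.
move=> AB [D D0 nB]; exists D => //; apply: null_sub nB => n.
by move=> /= /andP[/AB -> ->].
Qed.

Lemma small_or (A B : pred nat) : small A -> small B -> small [pred n | A n || B n].
Proof.
move=> [D D0 nA] [E E0 nB]; exists (D * E); first by rewrite muln_gt0 D0.
apply: null_sub (null_or nA nB) => n /= /andP[AB DEn].
have -> : D %| n by apply: dvdn_trans DEn; apply: dvdn_mulr.
have -> : E %| n by apply: dvdn_trans DEn; apply: dvdn_mull.
by rewrite !andbT.
Qed.

Lemma small_has (I : eqType) (s : seq I) (F : I -> pred nat) :
  {in s, forall i, small (F i)} -> small [pred n | has (fun i => F i n) s].
Proof.
elim: s => [_|i s IH sF].
  exists 1 => // e; exists 0 => T _.
  by rewrite /cnt big1 ?muln0.
have /small_or := sF i (mem_head _ _).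
have /[swap] /[apply] : small [pred n | has (fun i => F i n) s].
  by apply: IH => j js; apply: sF; rewrite inE js orbT.
by apply: small_sub => n.
Qed.

Lemma cnt_dilate (A : pred nat) j T :
  0 < j -> cnt [pred n | A (j * n)] T <= cnt A (j * T).
Proof.
move=> j0; elim: T => [|T IH]; first by rewrite /cnt !big_ord0.
rewrite {1}/cnt big_ord_recr /= mulnS [j + _]addnC.
have -> : cnt A (j * T + j) = cnt A (j * T) + \sum_(i < j) A (j * T + i).
  by rewrite /cnt big_split_ord.
rewrite leq_add //.
by case: j j0 {IH} => // j _; rewrite big_ord_recl addn0 leq_addr.
Qed.

Lemma small_dilate (A : pred nat) j :
  0 < j -> small A -> small [pred n | A (j * n)].
Proof.
move=> j0 [D D0 nA]; exists D => // e; have [T0 h] := nA (e * j).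
exists T0 => T T0T; have /h : T0 <= j * T by nia.
set C := [pred n | A n && (D %| n)].
have := cnt_dilate C T j0.
have : cnt [pred n | [pred n | A (j * n)] n && (D %| n)] T
        <= cnt [pred n | C (j * n)] T.
  by apply: cnt_sub => n /= /andP[-> /dvdn_mull ->].
move=> /leq_trans /[apply] le; rewrite [e * j]mulnC -mulnA leq_pmul2l //.
by apply: leq_trans; rewrite leq_mul2l le orbT.
Qed.

Lemma small_nonfull (A : pred nat) : small A -> exists2 t, 0 < t & ~~ A t.
Proof.
move=> [D D0 nA]; apply: contrapT => no.
have full t : 0 < t -> A t.
  by move=> t0; apply: contrapT => /negP At; apply: no; exists t.
(* A full set has at least [T0 + 2] multiples of [D] below [D * (T0 + 3)], as only 0 may be missing;
   at most half of [T0 + 3] are allowed. *)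
have [T0 h] := nA (2 * D); have := h (D * (T0 + 3)).
set C := [pred n | A n && (D %| n)].
have := cnt_dilate C (T0 + 3) D0.
have : T0 + 2 <= cnt [pred n | C (D * n)] (T0 + 3).
  rewrite /cnt addn3 big_ord_recl addn2.
  apply: leq_trans (leq_addl _ _).
  rewrite (eq_bigr (fun=> 1)); last first.
    move=> i _; rewrite /C /= full; first by rewrite dvdn_mulr.
    by rewrite muln_gt0 D0.
  by rewrite sum1_card card_ord.
nia.
Qed.

(** The dilated sets [{t | A (m * t)}] with [0 < m <= M] are small, hence so is their union, which
    must miss a positive [t]. *)
Lemma small_avoid (A : pred nat) M :
  small A -> exists2 t, 0 < t & forall m, 0 < m <= M -> ~~ A (m * t).
Proof.
move=> sA.
have /small_nonfull[t t0 /hasPn h] :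
    small [pred t | has (fun m => A (m * t)) (iota 1 M)].
  apply: (@small_has _ _ (fun m => [pred t | A (m * t)])) => m.
  by rewrite mem_iota => /andP[m0 _]; apply: small_dilate.
by exists t => // m mM; apply: h; rewrite mem_iota; lia.
Qed.

Lemma cnt_tail (A : pred nat) B T :
  cnt A T <= B + cnt [pred n | A n && (B <= n)] T.
Proof.
elim: T => [|T IH]; first by rewrite /cnt big_ord0.
case: (leqP B T) => BT.
  by move: IH; rewrite /cnt !big_ord_recr /= BT andbT; lia.
apply: leq_trans (leq_addr _ _); apply: leq_trans BT.
by rewrite -[leqRHS]card_ord -sum1_card; apply: leq_sum => i _; apply: leq_b1.
Qed.

Lemma large_unbounded (A : pred nat) D B :
  0 < D -> ~ small A -> exists n, [/\ A n, D %| n & B <= n].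
Proof.
move=> D0 lA; apply: contrapT => no; apply: lA; exists D => // e.
exists (e * B) => T; apply: leq_trans; rewrite leq_mul2l; apply/orP; right.
apply: leq_trans (cnt_tail _ B T) _.
rewrite [cnt _ _]big1 ?addn0 // => i _.
apply/eqP; rewrite eqb0; apply/negP => /= /andP[/andP[Ai Di] Bi].
by apply: no; exists i.
Qed.

(** * Translates and differences of sets of positive density *)

(* Some point lies in at least a [1/R]-fraction of the translates of [A] by
   the elements of [X], and [R] survives the deletion of an initial segment. *)
Lemma nonnull_translates (A : pred nat) : ~ null A ->
  exists R, forall B (X : seq nat), exists v,
    size X <= R * count (fun x => (x + B <= v) && A (v - x)) X.
Proof.
move=> nA.
have [e he] : exists e, forall T0, exists2 T, T0 <= T & T < e * cnt A T.
  apply: contrapT => no; apply: nA => e; apply: contrapT => no2.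
  apply: no; exists e => T0; apply: contrapT => no3; apply: no2.
  exists T0 => T T0T; rewrite leqNgt; apply/negP => lt; apply: no3.
  by exists T.
(* The factor 4 absorbs the points of [A] below [B] and the growth of the window from [T] to
   [T + L]. *)
exists (4 * e) => B X; pose L := sumn X.
have XL x : x \in X -> x <= L.
  rewrite /L; elim: (X) => //= y Y IH; rewrite inE => /orP[/eqP->|/IH]; lia.
have [T T0 Te] := he (L + 2 * e * B).
pose C := [pred n | A n && (B <= n)].
have Clarge : T + L < 4 * e * cnt C T by have := cnt_tail A B T; rewrite -/C; nia.
pose f v := count (fun x => (x + B <= v) && A (v - x)) X.
(* Double counting: shifting the points of [C] below [T] by any [x] in [X] keeps them in the
   window. *)
have dbl : size X * cnt C T <= \sum_(v < T + L) f v.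
  rewrite /f.
  under eq_bigr do rewrite -sum1_count big_mkcond /=.
  rewrite exchange_big /= -sum1_size big_distrl /= big_seq [leqRHS]big_seq.
  apply: leq_sum => x /XL xL; rewrite mul1n.
  have -> : T + L = x + (T + (L - x)) by lia.
  rewrite big_split_ord /= [leqRHS]addnC big_split_ord /= -addnA.
  apply: leq_trans (leq_addr _ _); apply: leq_sum => i _ /=.
  by rewrite leq_add2l addKn andbC.
apply: contrapT => no.
have lt v : 4 * e * f v < size X by rewrite ltnNge; apply/negP => h; apply: no; exists v.
have : \sum_(v < T + L) 4 * e * f v <= \sum_(v < T + L) size X.
  by apply: leq_sum => v _; apply: ltnW.
rewrite sum_nat_const card_ord -big_distrr /=.
apply/negP; rewrite -ltnNge.
apply: leq_trans (leq_mul (leqnn (4 * e)) dbl).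
by rewrite [size X * _]mulnC mulnA ltn_pmul2r // (leq_trans _ (lt 0)).
Qed.

Local Open Scope ring_scope.

(** A finite form of positive density; repetitions in [X] count, so a sequence with equal terms can
    be pigeonholed too. *)
Definition packed (R : nat) (S : pred int) := forall X : seq int,
  exists v : int, (size X <= R * count (fun x => S (v - x)%R) X)%N.

Definition diff (S : pred int) (z : int) :=
  exists p q, [/\ S p, S q & z = p - q].

Definition tail (A : pred nat) (B : nat) : pred int :=
  fun z => (B%:Z <= z) && A `|z|%N.

Lemma packedW R R' S : (R <= R')%N -> packed R S -> packed R' S.
Proof.
move=> RR' pS X; have [v h] := pS X; exists v.
by apply: leq_trans h _; rewrite leq_mul2r RR' orbT.
Qed.

Lemma packed_gt0 R S : packed R S -> (0 < R)%N.
Proof. by case: R => // /(_ [:: 0])[v]; rewrite mul0n. Qed.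

Lemma nonnull_packed (A : pred nat) :
  ~ null A -> exists R, forall B, packed R (tail A B).
Proof.
move=> /nonnull_translates[R h]; exists R => B X.
pose L := (\sum_(x <- X) `|x|)%N.
have XL x : x \in X -> 0 <= x + L%:Z.
  move=> xX; have : (`|x| <= L)%N by rewrite /L (big_rem x) //= leq_addr.
  lia.
have [v hv] := h B [seq `|(x + L%:Z)%R|%N | x <- X].
exists (v%:Z - L%:Z); move: hv; rewrite size_map count_map.
move=> /leq_trans; apply; rewrite leq_mul2l; apply/orP; right.
rewrite -!size_filter.
rewrite (@eq_in_filter _ _ (fun x => tail A B (v%:Z - L%:Z - x))) //.
move=> x /XL x0; rewrite /tail /=; case: leqP => hB /=.
  have -> : (B%:Z <= v%:Z - L%:Z - x) by lia.
  by congr (A _); lia.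
by symmetry; apply/andP => -[]; lia.
Qed.

Lemma diffN S z : diff S z -> diff S (- z).
Proof. by move=> [p [q [Sp Sq ->]]]; exists q, p; rewrite opprB. Qed.

Lemma count_ge2_subseq (T : eqType) (P : pred T) (s : seq T) :
  (1 < count P s)%N -> exists x y, [/\ P x, P y & subseq [:: x; y] s].
Proof.
rewrite -size_filter; case E: (filter P s) => [|x [|y u]] //= _.
have xin : x \in filter P s by rewrite E mem_head.
have yin : y \in filter P s by rewrite E !inE eqxx orbT.
move: xin yin; rewrite !mem_filter => /andP[Px _] /andP[Py _].
exists x, y; split=> //; apply: subseq_trans (filter_subseq P s).
by rewrite E /= !eqxx sub0seq.
Qed.

Lemma packed_pair R S (X : seq int) : packed R S -> (R < size X)%N ->
  exists x y, subseq [:: x; y] X /\ diff S (y - x).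
Proof.
move=> pS RX; have [v hv] := pS X.
have /count_ge2_subseq[x [y [Sx Sy sX]]] :
    (1 < count (fun x => S (v - x)%R) X)%N.
  by rewrite -(ltn_pmul2l (packed_gt0 pS)) muln1 (leq_trans RX hv).
exists x, y; split=> //; exists (v - x), (v - y); split=> //; ring.
Qed.

Lemma packed_pair_iota R S (f : nat -> int) : packed R S ->
  exists i j, (i < j <= R)%N /\ diff S (f j - f i).
Proof.
move=> pS; have [v] := pS [seq f i | i <- iota 0 R.+1].
rewrite size_map size_iota count_map => hv.
have /count_ge2_subseq[i [j [Si Sj ss]]] :
  (1 < count (preim f (fun x => S (v - x)%R)) (iota 0 R.+1))%N.
  by rewrite -(ltn_pmul2l (packed_gt0 pS)) muln1.
exists i, j; split; last first.
  by exists (v - f i), (v - f j); split=> //; ring.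
have : (j \in iota 0 R.+1) by apply: (mem_subseq ss); rewrite !inE eqxx orbT.
have := subseq_sorted ltn_trans ss (iota_ltn_sorted 0 R.+1).
by rewrite mem_iota /=; lia.
Qed.

(** * Sums of boundedly many differences *)

Definition diffsum (S : pred int) (k : nat) (z : int) :=
  exists s : seq int, [/\ size s = k, {in s, forall x, diff S x}
                        & z = \sum_(x <- s) x].

Lemma packed_nonempty R S : packed R S -> exists a, S a.
Proof.
by move=> /(@packed_pair_iota R S (fun=> 0))[_ [_ [_ [p [_ [Sp _ _]]]]]]; exists p.
Qed.

Lemma diffsum_widen R S k l z :
  packed R S -> (k <= l)%N -> diffsum S k z -> diffsum S l z.
Proof.
move=> /packed_nonempty[a Sa] kl [s [sk sd ->]].
exists (s ++ nseq (l - k) 0); split.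
- by rewrite size_cat size_nseq sk; lia.
- move=> x; rewrite mem_cat => /orP[/sd //|/nseqP[-> _]].
  by exists a, a; rewrite subrr.
- by rewrite big_cat big_nseq /= iter_addr_0 mul0rn addr0.
Qed.

(* Two of the partial sums of even length differ by a single difference, which
   can replace the at least two summands in between. *)
Lemma diffsum_shorten R S k z : packed R S -> (2 * R <= k.+1)%N ->
  diffsum S k.+1 z -> diffsum S k z.
Proof.
move=> pS Rk [s [sk sd ->]].
have [i [j [ij d]]] :=
  packed_pair_iota (fun i => \sum_(x <- take (2 * i) s) x) pS.
set e := _ - _ in d.
apply: (@diffsum_widen R S (size (take (2 * i) s ++ e :: drop (2 * j) s))) => //.
  by rewrite size_cat /= size_take size_drop sk; case: ifP; lia.
exists (take (2 * i) s ++ e :: drop (2 * j) s); split=> //.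
  move=> x; rewrite mem_cat inE => /or3P[/mem_take/sd|/eqP->|/mem_drop/sd] //.
rewrite big_cat big_cons /= -{1}(cat_take_drop (2 * j) s) big_cat /=.
by rewrite /e; ring.
Qed.

Lemma diffsum_bounded R S k z :
  packed R S -> diffsum S k z -> diffsum S (2 * R) z.
Proof.
move=> pS; elim: k => [|k IH] h; first exact: diffsum_widen h.
have [kR|Rk] := leqP k.+1 (2 * R); first exact: diffsum_widen h.
by apply: IH; apply: diffsum_shorten pS _ h; apply: ltnW.
Qed.

(** * The subgroup generated by [S - S] *)

Definition diffspan S z := exists k, diffsum S k z.

Lemma diffspan_diff S z : diff S z -> diffspan S z.
Proof.
move=> d; exists 1, [:: z]; split=> //; last by rewrite big_seq1.
by move=> x; rewrite inE => /eqP->.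
Qed.

Lemma diffspan0 S : diffspan S 0.
Proof. by exists 0, [::]; split=> //; rewrite big_nil. Qed.

Lemma diffspanD S x y : diffspan S x -> diffspan S y -> diffspan S (x + y).
Proof.
move=> [k [s [sk sd ->]]] [l [u [ul ud ->]]]; exists (k + l)%N, (s ++ u).
split; first by rewrite size_cat sk ul.
  by move=> z; rewrite mem_cat => /orP[/sd|/ud].
by rewrite big_cat.
Qed.

Lemma diffspanN S x : diffspan S x -> diffspan S (- x).
Proof.
move=> [k [s [sk sd ->]]]; exists k, [seq - x | x <- s]; split.
- by rewrite size_map.
- by move=> _ /mapP[z /sd d ->]; apply: diffN.
- by rewrite big_map sumrN.
Qed.

Lemma diffspanMz S x m : diffspan S x -> diffspan S (m * x).
Proof.
move=> Sx.
have nat_case n : diffspan S (n%:Z * x).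
  elim: n => [|n IH]; first by rewrite mul0r; apply: diffspan0.
  by rewrite -addn1 PoszD mulrDl mul1r; apply: diffspanD.
case: m => n; first exact: nat_case.
by rewrite NegzE mulNr; apply: diffspanN.
Qed.

(** Pigeonhole on [0, ..., R] puts some [j - i <= R] in [S - S], and it divides the factorial. *)
Lemma diffspan_fact R S z : packed R S -> (R`!%:Z %| z)%Z -> diffspan S z.
Proof.
move=> /(packed_pair_iota (fun i => i%:Z))[i [j [ij d]]] /dvdzP[m ->].
have /dvdnP[q ->] : (j - i %| R`!)%N by apply: dvdn_fact; lia.
rewrite PoszM mulrA; apply: diffspanMz; apply: diffspan_diff.
by rewrite -subzn //; lia.
Qed.

(** All of [S] lies in one coset of the span, and [a] shows that this coset is the span itself. *)
Lemma diffspan_mem R S a z :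
  packed R S -> S a -> (R`!%:Z %| a)%Z -> S z -> diffspan S z.
Proof.
move=> pS Sa /(diffspan_fact pS) Ha Sz; rewrite -(subrK a z).
by apply: diffspanD => //; apply: diffspan_diff; exists z, a.
Qed.

(** A maximal set of span elements with mutual differences outside [S - S] covers the span; more
    than [R] elements would contradict [packed_pair]. *)
Lemma diffspan_cover R S : packed R S ->
  exists X : seq int, [/\ (size X <= R)%N, {in X, forall x, diffspan S x}
    & forall w, diffspan S w -> exists2 x, x \in X & diff S (w - x)].
Proof.
move=> pS; apply: contrapT => no.
pose sep x y := ~~ `[< diff S (x - y) >].
have [X [sX HX pX]] : exists X : seq int,
    [/\ size X = R.+1, {in X, forall x, diffspan S x} & pairwise sep X].
  elim: {1 3}R.+1 (leqnn R.+1) => [|m IH] mR; first by exists [::].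
  have [|X [sX HX pX]] := IH; first by lia.
  have [w [Hw nw]] : exists w, diffspan S w /\ forall x, x \in X -> ~ diff S (w - x).
    apply: contrapT => no2; apply: no; exists X; split=> //; first by lia.
    move=> w Hw; apply: contrapT => no3; apply: no2; exists w; split=> // x xX d.
    by apply: no3; exists x.
  exists (w :: X); split; first by rewrite /= sX.
    by move=> x; rewrite inE => /orP[/eqP->|/HX].
  rewrite /= pX andbT; apply/allP => x /nw nd.
  by apply/negP => /asboolP.
have [|x [y [ss d]]] := packed_pair (X := X) pS; first by rewrite sX.
have := subseq_pairwise ss pX; rewrite /= !andbT => /negP; apply.
by apply/asboolP; rewrite -opprB; apply: diffN.
Qed.

(** * Sumsets, for large [n] *)

Lemma diffsum_split S k z : diffsum S k z ->
  exists ps qs : seq int, [/\ size ps = k, size qs = k, all S ps, all S qs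
    & z = \sum_(x <- qs) x - \sum_(x <- ps) x].
Proof.
move=> [s [<- sd ->]] {k z}; elim: s sd => [|d s IH] sd.
  by exists [::], [::]; split=> //; rewrite !big_nil subr0.
have [|ps [qs [sp sq Sp Sq e]]] := IH.
  by move=> x xs; apply: sd; rewrite inE xs orbT.
have [q [p [Sq' Sp' ->]]] := sd d (mem_head _ _).
exists (p :: ps), (q :: qs); split=> /=; rewrite ?sp ?sq ?Sp' ?Sq' //.
by rewrite !big_cons e; ring.
Qed.

(* Summands not used to reach [x] are frozen at their value in [qs]. *)
Lemma sumset_translate S k (X : seq int) : {in X, forall x, diffsum S k x} ->
  exists qs : seq int, [/\ size qs = (k * size X)%N, all S qs
    & {in X, forall x, exists ps : seq int,
        [/\ size ps = (k * size X)%N, all S ps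
          & \sum_(p <- ps) p = \sum_(q <- qs) q - x]}].
Proof.
elim: X => [|x X IH] HX; first by exists [::]; split=> //=; rewrite muln0.
have [|qs [sq Sq hq]] := IH.
  by move=> y yX; apply: HX; rewrite inE yX orbT.
have [p' [q' [sp' sq' Sp' Sq' ex]]] := diffsum_split (HX x (mem_head _ _)).
exists (q' ++ qs); split.
- by rewrite size_cat sq' sq mulnS.
- by rewrite all_cat Sq'.
move=> y; rewrite inE => /orP[/eqP->|/hq[ps [sp Sp e]]].
  exists (p' ++ qs); rewrite size_cat all_cat sp' sq mulnS Sp' Sq; split=> //.
  by rewrite !big_cat /= ex; ring.
exists (q' ++ ps); rewrite size_cat all_cat sp sq' mulnS Sp Sq'; split=> //.
by rewrite !big_cat /= e; ring.
Qed.

Lemma sum_nseq_int n (x : int) : \sum_(i <- nseq n x) i = n%:Z * x.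
Proof. by rewrite big_nseq iter_addr_0 -mulr_natl natz. Qed.

(** The span contains [sum qs + m a - z], which is thus [x + s - b] with [x] in [X]. As [ps] sums to
    [sum qs - x], adding [b] and [m] copies of [a] gives [s + z]. *)
Lemma sumset_hits_translate R S a n z : packed R S -> S a ->
  (R`!%:Z %| a)%Z -> (2 * R * R < n)%N -> (R`!%:Z %| z)%Z ->
  exists (bs : seq int) (s : int),
    [/\ size bs = n, all S bs, S s & \sum_(b <- bs) b = s + z].
Proof.
move=> pS Sa Da nR Dz; have [X [sX HX cX]] := diffspan_cover pS.
have [|qs [sq Sq hq]] := @sumset_translate S (2 * R) X.
  by move=> x /HX[k]; apply: diffsum_bounded.
(* The list [ps] and [b] take at most [2 * R * R + 1 <= n] summands; copies of [a] fill the rest. *)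
pose m := (n - (2 * R * size X).+1)%N.
have Hq : diffspan S (\sum_(q <- qs) q).
  elim: (qs) Sq => [|q u IH] /=; first by rewrite big_nil => _; apply: diffspan0.
  case/andP=> Sq Su; rewrite big_cons; apply: diffspanD; last exact: IH.
  exact: diffspan_mem pS Sa Da Sq.
have [|x xX [s [b [Ss Sb e]]]] := cX (\sum_(q <- qs) q + m%:Z * a - z).
  apply: diffspanD; last by apply: diffspanN; apply: diffspan_fact pS Dz.
  by apply: diffspanD => //; apply: diffspanMz; exact: (diffspan_mem pS Sa Da).
have [ps [sp Sp eP]] := hq x xX.
exists (b :: ps ++ nseq m a), s; split=> //.
- rewrite /= size_cat size_nseq sp /m.
  have : (2 * R * size X <= 2 * R * R)%N by rewrite leq_mul2l sX orbT.
  lia.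
- by rewrite /= Sb all_cat Sp all_nseq Sa orbT.
- rewrite big_cons big_cat /= eP sum_nseq_int.
  by rewrite -[s](subrK b) -e; ring.
Qed.

(** * Common differences, for the remaining [n] *)

(** Each [q] in turn keeps a [1/R]-fraction of the candidates [y], those with [v - l q * y] in [F q]
    for one [v]; two survive and differ by [d]. The bound on [d] is independent of [l], so it can be
    fixed first. *)
Lemma packed_common_diff (I : eqType) R (F : I -> pred int) (l : I -> int)
    (qs : seq I) : {in qs, forall q, packed R (F q)} ->
  exists2 d : nat, (0 < d <= R ^ size qs * 2)%N
    & {in qs, forall q, diff (F q) (l q * d%:Z)}.
Proof.
move=> pF.
have main (Y : seq nat) m : (R ^ size qs * m <= size Y)%N ->
    exists Y', [/\ subseq Y' Y, (m <= size Y')%N &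
      {in qs, forall q, exists v, all (fun y : nat => F q (v - l q * y%:Z)) Y'}].
  elim: qs pF Y => [|q qs IH] pF Y h; first by exists Y; rewrite -{1}(mul1n m); split.
  have [v] := pF q (mem_head _ _) [seq l q * y%:Z | y <- Y].
  rewrite size_map count_map -size_filter; set Y1 := filter _ _ => hv.
  have [||Y' [s1 s2 s3]] := IH _ Y1.
  - by move=> r rq; apply: pF; rewrite inE rq orbT.
  - rewrite -(leq_pmul2l (packed_gt0 (pF q (mem_head _ _)))) mulnA -expnS.
    exact: leq_trans h hv.
  exists Y'; split=> //; first exact: subseq_trans s1 (filter_subseq _ _).
  move=> r; rewrite inE => /orP[/eqP->|/s3 //].
  exists v; apply/allP => y /(mem_subseq s1).
  by rewrite mem_filter => /andP[].
have [|[|y1 [|y2 Y]] [ss // _ hv]] := main (iota 0 (R ^ size qs * 2).+1) 2.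
  by rewrite size_iota.
have /= := subseq_sorted ltn_trans ss (iota_ltn_sorted 0 _).
have : y2 \in iota 0 (R ^ size qs * 2).+1.
  by apply: (mem_subseq ss); rewrite !inE eqxx orbT.
rewrite mem_iota => y2R /andP[y12 _].
exists (y2 - y1)%N; first by lia.
move=> q /hv[v /and3P[F1 F2 _]]; exists (v - l q * y1%:Z), (v - l q * y2%:Z).
split=> //; rewrite -subzn; [ring | lia].
Qed.

(** * Choice of [y] and solution of the system *)

Lemma packed_uniform (K : finType) (A : K -> pred nat) :
  exists R, forall k, ~ small (A k) -> forall B, packed R (tail (A k) B).
Proof.
have /choice[f hf] : forall k, exists R,
    ~ small (A k) -> forall B, packed R (tail (A k) B).
  move=> k; case: (pselect (small (A k))) => [sk|lk]; first by exists 0%N.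
  have [|R hR] := @nonnull_packed (A k); last by exists R.
  move=> nA; apply: lk; exists 1%N => //.
  by apply: null_sub nA => n /= /andP[].
exists (\max_k f k)%N => k /hf pk B.
by apply: packedW (pk B); apply: leq_bigmax.
Qed.

Lemma tailW (A : pred nat) B B' z : (B' <= B)%N -> tail A B z -> tail A B' z.
Proof. by move=> BB /andP[Bz Az]; rewrite /tail Az andbT; lia. Qed.

Lemma tail_nat (A : pred nat) B n : (B <= n)%N -> A n -> tail A B n%:Z.
Proof. by move=> Bn An; rewrite /tail lez_nat Bn. Qed.

Lemma cover_solution (K : finType) (A : K -> pred nat) (a : nat -> int) :
  (forall n, (0 < n)%N -> exists k, A k n) ->
  exists k y, [/\ (0 < y)%N, A k y & forall n, (0 < n)%N ->
    exists (bs : seq int) (s : int),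
      [/\ size bs = n, all (tail (A k) 1) bs,
          {in bs, forall b, a n * y%:Z < b}, tail (A k) 1 s
        & \sum_(b <- bs) b = s + n%:Z * (a n * y%:Z)]].
Proof.
move=> cov; have [R hR] := packed_uniform A.
pose D := R`!; have D0 : (0 < D)%N := fact_gt0 R.
pose N := (2 * R * R)%N; pose P := (\max_(n < N.+1) `|a n|)%N.
(* As [g] exceeds [|a n|] for [n <= N], so does [g^(j-i)], the ratio of [u] to [y]; [r + 1]
   exponents force two equal colours. *)
pose g := P.+1; pose r := #|K|.
(* Colour and exponents are still unknown, so all [(k, n, i, j)] with [k] large are treated at
   once. *)
pose qs := [seq q : K * 'I_N.+1 * 'I_r.+1 * 'I_r.+1 <- enum predT
             | ~~ `[< small (A q.1.1.1) >]].
pose M := (R ^ size qs * 2)%N.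
pose Z n := has (fun k => A k n) [seq k <- enum K | `[< small (A k) >]].
have sZ : small Z.
  apply: small_has => k; rewrite mem_filter => /andP[h _].
  exact/asboolP.
(* Whatever [d <= M] turns out to be, each [Y i] below is one of these multiples of [t]. *)
have [t t0 ht] := small_avoid (M * D * g ^ r) sZ.
(* This exceeds every [P * Y i], so the tail lies above [a n * y] for [n <= N]. *)
pose B := (P * (M * D * g ^ r * t)).+1.
(* Times [d], this is [n a_n Y_i - (n-1) Y_j], the wanted [b - s]. *)
pose l (q : K * 'I_N.+1 * 'I_r.+1 * 'I_r.+1) : int :=
  (q.1.1.2%:Z * a q.1.1.2 * g%:Z ^+ q.1.2 - (q.1.1.2%:Z - 1) * g%:Z ^+ q.2)
  * (D * t)%N%:Z.
have [|d /andP[d0 dM] hd] :=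
  @packed_common_diff _ R (fun q => tail (A q.1.1.1) B) l qs.
  by move=> q; rewrite mem_filter => /andP[/negP h _]; apply: hR => /asboolP.
pose Y i := (d * D * g ^ i * t)%N.
have Y0 i : (0 < Y i)%N by rewrite !muln_gt0 d0 D0 t0 expn_gt0.
have YM (i : 'I_r.+1) : (d * D * g ^ i <= M * D * g ^ r)%N.
  by apply: leq_mul; [apply: leq_mul | rewrite leq_pexp2l // -ltnS].
have /choice[f hf] : forall i : 'I_r.+1, exists k, A k (Y i) /\ ~ small (A k).
  move=> i; have [k Ak] := cov _ (Y0 i); exists k; split=> // sk.
  have /negP[] : ~~ Z (Y i) by apply: ht; rewrite YM !muln_gt0 d0 D0 expn_gt0.
  by apply/hasP; exists k => //; rewrite mem_filter mem_enum andbT; apply/asboolP.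
have [i [j [ij fij]]] : exists i j : 'I_r.+1, (i < j)%N /\ f i = f j.
  apply: contrapT => no; have /leq_card : injective f.
    move=> i j e; apply: val_inj; case: (ltngtP i j) => // h; case: no.
      by exists i, j.
    by exists j, i.
  by rewrite card_ord ltnn.
have [Ai li] := hf i; have [Aj _] := hf j; rewrite -fij in Aj.
move: (f i) Ai li Aj => k Ai li Aj {hf fij f}.
have YY : (P * Y i < Y j)%N.
  have -> : Y j = (g ^ (j - i) * Y i)%N.
    by rewrite /Y -{1}(subnK (ltnW ij)) expnD; ring.
  rewrite ltn_pmul2r //; apply: leq_trans (_ : g ^ 1 <= _)%N => //.
  by rewrite leq_pexp2l //; lia.
exists k, (Y i); split=> // n n0; case: (leqP n N) => nN.
- have aP : (`|a n| <= P)%N.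
    by rewrite -(inordK (nN : n < N.+1)%N); apply: (leq_bigmax (inord n : 'I_N.+1)).
  have aY : a n * (Y i)%:Z <= (P * Y i)%N%:Z.
    rewrite PoszM ler_wpM2r //; lia.
  have [|b [s [Sb Ss e]]] := hd (k, inord n, i, j).
    rewrite mem_filter mem_enum andbT /=; apply/negP => /asboolP; exact: li.
  exists (b :: nseq n.-1 (Y j)%:Z), s; split.
  + by rewrite /= size_nseq prednK.
  + by rewrite /= (tailW _ Sb) //= all_nseq tail_nat ?orbT.
  + move=> x; rewrite inE => /orP[/eqP->|/nseqP[-> _]].
      apply: le_lt_trans aY _; apply: lt_le_trans (_ : B%:Z <= _); last first.
        by case/andP: Sb.
      by rewrite ltz_nat ltnS leq_mul2l leq_mul2r YM !orbT.
    by apply: le_lt_trans aY _; rewrite ltz_nat.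
  + exact: tailW Ss.
  + rewrite big_cons sum_nseq_int -[b](subrK s) -e /l /= inordK //.
    rewrite /Y !PoszM -!natz !natrX !natz -subn1 -subzn //; ring.
(* Here the tail varies with [n], starting beyond [|a n| * y]; the same [R] serves all tails. *)
- have [m [Am Dm Bm]] := @large_unbounded (A k) D (`|a n| * Y i).+1 D0 li.
  have Dy : (D%:Z %| n%:Z * (a n * (Y i)%:Z))%Z.
    apply: dvdz_mull; apply: dvdz_mull; rewrite dvdzE /=.
    by apply/dvdn_mulr/dvdn_mulr/dvdn_mull.
  have [bs [s [sb Sb Ss e]]] := sumset_hits_translate
    (hR k li (`|a n| * Y i).+1) (tail_nat Bm Am) Dm nN Dy.
  exists bs, s; split=> //.
  + by apply: sub_all Sb => x; apply: tailW.
  + move=> b /(allP Sb)/andP[h _]; apply: lt_le_trans h.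
    apply: le_lt_trans (_ : (`|a n| * Y i)%N%:Z < _); last by rewrite ltz_nat.
    by rewrite PoszM ler_wpM2r //; lia.
  + exact: tailW Ss.
Qed.

Theorem theorem2 (a : posnat -> int) (K : finType) (c : posnat -> K) :
  exists (y : posnat) (x : forall n : posnat, 'I_n -> posnat) (k : K),
    [/\ has_colour c k y%:Z,
        forall n : posnat, has_colour c k (\sum_(i < n) (x n i)%:Z)
      & forall (n : posnat) (i : 'I_n), has_colour c k ((x n i)%:Z + a n * y%:Z)].
Proof.
(* [insub 0] is [None], so 0 lies in no class, and [a' 0] takes the default 0. *)
pose A k (n : nat) := omap c (insub n) == Some k.
pose a' (n : nat) := odflt 0 (omap a (insub n)).
have a'E (n : posnat) : a' n = a n by rewrite /a' valK.
have colP k (z : int) : tail (A k) 1 z -> has_colour c k z.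
  case/andP=> z0; rewrite /A; case: insubP => // m m0 mz /eqP[ck].
  by exists m; split=> //; rewrite /nat_of_posnat mz; lia.
have [n n0|k [y [y0 Ay hy]]] := @cover_solution K A a'.
  by exists (c (Sub n n0)); rewrite /A insubT.
have hx (n : posnat) : exists x : 'I_n -> posnat,
    has_colour c k (\sum_(i < n) (x i)%:Z)
    /\ forall i, has_colour c k ((x i)%:Z + a n * y%:Z).
  have [bs [s [sb Sb lb Ss e]]] := hy n (valP n).
  rewrite a'E in lb e.
  pose b (i : 'I_n) := nth 0 bs i.
  have bb i : b i \in bs by rewrite mem_nth // sb.
  have pos i : (0 < `|(b i - a n * y%:Z)%R|)%N by have := lb _ (bb i); lia.
  have xE i : `|(b i - a n * y%:Z)%R|%N%:Z = b i - a n * y%:Z.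
    by have := lb _ (bb i); lia.
  exists (fun i => Sub _ (pos i)); split=> [|i].
    under eq_bigr do rewrite /nat_of_posnat SubK xE.
    rewrite sumrB sumr_const card_ord -mulr_natl natz.
    move: e; rewrite (big_nth 0) big_mkord sb => -> .
    by rewrite addrK; apply: colP.
  rewrite /nat_of_posnat SubK xE subrK; apply: colP.
  exact: (allP Sb).
exists (Sub y y0), (fun n => sval (cid (hx n))), k; split=> [|n|n i].
- by apply: colP; apply: tail_nat.
- by case: cid => x [].
- by case: cid => x [].
Qed.
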